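(* Let $\mathcal{A}$ be a cluster algebra (of geometric type, over $\mathbb{C}$) of rank $n$, with its labeled seed pattern $(\Sigma_t)_{t\in\mathbb{T}_n}$ on the $n$-regular tree $\mathbb{T}_n$, and let $T$ be a finite subtree of $\mathbb{T}_n$. Let $\mathbf{z}_T$, $\mathcal{Z}_T$, $\mathcal{A}_T$, $I_T$, and $J_T$ be the associated set of formal variables, set of cluster and coefficient variables, subalgebra, exchange ideal and saturated ideal defined in the context. Then for a polynomial $f=f(\mathbf{z}_T)\in\mathbb{C}[\mathbf{z}_T]$, the following are equivalent: (a) $f(\mathcal{Z}_T)=0$ in $\mathcal{A}_T$, i.e., $f$ vanishes when each formal variable is replaced by the corresponding cluster or coefficient variable; (b) $f\in J_T$. Consequently, evaluation induces a canonical isomorphism $\mathcal{A}_T\cong\mathbb{C}[\mathbf{z}_T]/J_T$.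
   Context: Cluster algebra conventions. Let $\mathcal{F}$ be a field isomorphic to the field of rational functions over $\mathbb{C}$ in $m$ variables, and let $n\le m$. A labeled seed of rank $n$ in $\mathcal{F}$ is a pair $(\tilde{\mathbf{x}},\tilde B)$ where $\tilde{\mathbf{x}}=(x_1,\dots,x_m)$ is algebraically independent over $\mathbb{C}$ with $\mathcal{F}=\mathbb{C}(x_1,\dots,x_m)$, and $\tilde B=(b_{ij})$ is an $m\times n$ integer matrix whose top $n\times n$ submatrix is skew-symmetrizable. The elements $x_1,\dots,x_n$ are the cluster variables of the seed (forming its cluster) and $x_{n+1},\dots,x_m$ are the frozen (coefficient) variables. For $1\le k\le n$, the mutation $\mu_k$ replaces $x_k$ by $x_k'$ defined by the exchange relation $x_kx_k'=\prod_{b_{ik}>0}x_i^{b_{ik}}+\prod_{b_{ik}<0}x_i^{-b_{ik}}$ (other $x_i$ unchanged), and replaces $\tilde B$ by $\tilde B'=(b'_{ij})$ with $b'_{ij}=-b_{ij}$ if $i=k$ or $j=k$, and $b'_{ij}=b_{ij}+\tfrac12(|b_{ik}|b_{kj}+b_{ik}|b_{kj}|)$ otherwise. $\mathbb{T}_n$ is the $n$-regular tree whose edges are labeled by $1,\dots,n$ so that the $n$ edges at each vertex have different labels. A seed pattern assigns a labeled seed $\Sigma_t$ to each vertex $t$ of $\mathbb{T}_n$ so that seeds at the ends of an edge labeled $k$ are related by $\mu_k$; all seeds share the same frozen variables. The cluster algebra $\mathcal{A}\subset\mathcal{F}$ is the $\mathbb{C}$-subalgebra generated by all frozen variables and all cluster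 variables of all seeds in the pattern. Objects attached to $T$. For $i\in\{1,\dots,n\}$ let $T[i]$ be the forest obtained from $T$ by removing the edges labeled $i$ (keeping all vertices). Let $\mathbf{z}_T$ be the finite set of formal variables consisting of: one formal variable for each coefficient variable of $\mathcal{A}$; and, for each $i\in\{1,\dots,n\}$, one formal variable for each connected component of $T[i]$. The formal variable attached to a component $C$ of $T[i]$ corresponds to the unique cluster variable that has index $i$ in every labeled seed $\Sigma_t$, $t\in C$. $\mathbb{C}[\mathbf{z}_T]$ is the polynomial ring in these variables. The exchange ideal $I_T\subset\mathbb{C}[\mathbf{z}_T]$ is the ideal generated by the polynomials $zz'-M_1-M_2$, one for each edge of $T$, where $zz'=M_1+M_2$ is the exchange relation for that edge written in the formal variables (with $z,z'\in\mathbf{z}_T$ and $M_1,M_2$ monomials in $\mathbf{z}_T$). $\mathcal{Z}_T$ is the set of all cluster and coefficient variables appearing in the seeds at the vertices of $T$, and $\mathcal{A}_T\subset\mathcal{A}$ is the $\mathbb{C}$-subalgebra generated by $\mathcal{Z}_T$. For $f\in\mathbb{C}[\mathbf{z}_T]$, $f(\mathcal{Z}_T)\in\mathcal{A}_T$ denotes its evaluation at the corresponding cluster and coefficient variables. Let $M_T$ be the product of all formal variables in $\mathbf{z}_T$ corresponding to (mutable) cluster variables, i.e., not to coefficient variables. Then $J_T=(I_T:\langle M_T\rangle^\infty)=\{f\in\mathbb{C}[\mathbf{z}_T] : (M_T)^a f\in I_T\text{ for some integer }a\ge 0\}$. *)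

(* Defs.v *)
(* boolp is used only to turn propositions into booleans, and
   reals for the field of complex numbers R[i] over a realType R. *)
From HB Require Import structures.
From mathcomp Require Import all_boot all_order all_algebra.
From mathcomp Require Import finmap.
From mathcomp Require Import mpoly.
From mathcomp Require Import complex boolp reals.

Set Implicit Arguments.
Unset Strict Implicit.
Unset Printing Implicit Defensive.

Import GRing.Theory.
Local Open Scope ring_scope.

(* The n-regular tree with edges labeled by 'I_n is modeled by the Cayley graph
   of the free product of n copies of Z/2: vertices are the words without two
   equal consecutive letters, and the neighbor of w along the edge labeled k is
   k :: w, or behead w if w already starts with k. *)
Definition reduced (n : nat) (w : seq 'I_n) : bool :=
  sorted (fun a b : 'I_n => a != b) w.

Record regtree (n : nat) := RegTree { word : seq 'I_n; _ : reduced word }.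
HB.instance Definition _ (n : nat) := [isSub for @word n].
HB.instance Definition _ (n : nat) := [Countable of regtree n by <:].

Definition regtree_root (n : nat) : regtree n := @RegTree n [::] isT.

Definition tedge (n : nat) (k : 'I_n) (t t' : regtree n) : bool :=
  (word t' == k :: word t) || (word t == k :: word t').

Section RegularTree.
Variable n : nat.

Lemma tedge_sym (k : 'I_n) : ssrbool.symmetric (tedge k).
Proof. by move=> t t'; rewrite /tedge orbC. Qed.

Lemma tedge_ex (k : 'I_n) (t : regtree n) : exists t', tedge k t t'.
Proof.
case: t => -[|a w] wP.
  by exists (@RegTree n [:: k] isT); rewrite /tedge eqxx.
have [eka|nka] := eqVneq k a.
  have wP' : reduced w by move: wP; rewrite /reduced /= => /path_sorted.
  by exists (RegTree wP'); rewrite /tedge /= eka eqxx orbT.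
have wP' : reduced [:: k, a & w] by rewrite /reduced /= nka; exact: wP.
by exists (RegTree wP'); rewrite /tedge eqxx.
Qed.

Lemma tedge_inj (k : 'I_n) (t t1 t2 : regtree n) :
  tedge k t t1 -> tedge k t t2 -> t1 = t2.
Proof.
case: t t1 t2 => [w wP] [w1 w1P] [w2 w2P]; rewrite /tedge /=.
have no2 v : reduced [:: k, k & v] -> False by rewrite /reduced /= eqxx.
move=> /orP[]/eqP e1 /orP[]/eqP e2; apply: val_inj => /=.
- by rewrite e1 e2.
- by case: (no2 w2); rewrite -e2 -e1.
- by case: (no2 w1); rewrite -e1 -e2.
- by move: e2; rewrite e1 => -[].
Qed.

End RegularTree.

Section Subtree.
Variables (n : nat) (T : {fset regtree n}).

(* Subtrees are given by their vertices: in a tree, a connected subgraph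
   contains every edge joining two of its vertices. *)
Definition sub_adj (s t : T) : bool := [exists k, tedge k (val s) (val t)].

Definition is_subtree : Prop := T != fset0 /\ forall s t : T, connect sub_adj s t.

Definition del_adj (i : 'I_n) (s t : T) : bool :=
  [exists k, (k != i) && tedge k (val s) (val t)].

Definition comp (i : 'I_n) (t : T) : {set T} := [set s | connect (del_adj i) t s].

Definition components (i : 'I_n) : {set {set T}} := [set comp i t | t : T].

(* pairs (i, C) with C a connected component of T[i] *)
Definition mutable_var := {iC : 'I_n * {set T} | iC.2 \in components iC.1}.
HB.instance Definition _ := Finite.on mutable_var.

Lemma comp_in (i : 'I_n) (t : T) : (i, comp i t).2 \in components (i, comp i t).1.
Proof. exact: imset_f. Qed.

Definition comp_var (i : 'I_n) (t : T) : mutable_var := Sub (i, comp i t) (comp_in i t).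

Lemma component_neq0 (v : mutable_var) : exists t, t \in (val v).2.
Proof.
case: v => -[i C] /= /imsetP[t _ ->]; exists t.
by rewrite inE connect0.
Qed.

Definition component_rep (v : mutable_var) : T := xchoose (component_neq0 v).

End Subtree.

Section FormalVariables.
Variables (n p : nat) (T : {fset regtree n}).

Definition fvar := ('I_p + mutable_var T)%type.
HB.instance Definition _ := Finite.on fvar.

Definition fvar_at (t : T) (i : 'I_(n + p)) : fvar :=
  match split i with
  | inl j => inr (comp_var j t)
  | inr j => inl j
  end.

End FormalVariables.

Section ClusterAlgebras.
Variables (K F : fieldType) (iota : {rmorphism K -> F}).

Definition is_rational_function_field (m : nat) : Prop :=
  exists phi : {rmorphism {fraction {mpoly K[m]}} -> F},
    bijective phi /\ forall c : K, phi (tofrac (c%:MP_[m])) = iota c.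

Definition algebraically_independent (m : nat) (x : 'I_m -> F) : Prop :=
  forall f : {mpoly K[m]}, mmap iota x f = 0 -> f = 0.

Definition generates_field (m : nat) (x : 'I_m -> F) : Prop :=
  forall y : F, exists a b : {mpoly K[m]},
    mmap iota x b != 0 /\ y = mmap iota x a / mmap iota x b.

Definition skew_symmetrizable (n : nat) (B : 'M[int]_n) : Prop :=
  exists d : 'I_n -> nat, (forall i, (0 < d i)%N) /\
    forall i j, (d i)%:Z * B i j = - ((d j)%:Z * B j i).

Section Seeds.
Variables n p : nat.

(* The m of the extended cluster is n + p: the indices lshift p i are mutable
   and the indices rshift n j are frozen. *)
Record labeled_seed := LabeledSeed {
  xvar : {ffun 'I_(n + p) -> F};
  exmx : 'M[int]_(n + p, n) }.

Definition is_labeled_seed (S : labeled_seed) : Prop :=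
  [/\ algebraically_independent (xvar S),
      generates_field (xvar S) &
      skew_symmetrizable (usubmx (exmx S))].

Definition mutate_x (k : 'I_n) (S : labeled_seed) : {ffun 'I_(n + p) -> F} :=
  [ffun i => if i == lshift p k then
     (\prod_(j | 0 < exmx S j k) xvar S j ^+ `|exmx S j k|%N +
      \prod_(j | exmx S j k < 0) xvar S j ^+ `|exmx S j k|%N) / xvar S i
   else xvar S i].

(* The integer division by 2 is exact: |a| b + a |b| is 0 or 2 a b or - 2 a b. *)
Definition mutate_mx (k : 'I_n) (B : 'M[int]_(n + p, n)) : 'M[int]_(n + p, n) :=
  \matrix_(i, j)
    if (i == lshift p k) || (j == k) then - B i j
    else B i j + ((`|B i k| * B (lshift p k) j
                   + B i k * `|B (lshift p k) j|) %/ 2)%Z.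

Definition mutate (k : 'I_n) (S : labeled_seed) : labeled_seed :=
  LabeledSeed (mutate_x k S) (mutate_mx k (exmx S)).

Definition is_seed_pattern (Sigma : regtree n -> labeled_seed) : Prop :=
  (forall t, is_labeled_seed (Sigma t)) /\
  (forall k t t', tedge k t t' -> Sigma t' = mutate k (Sigma t)).

Section Evaluation.
Variables (Sigma : regtree n -> labeled_seed) (T : {fset regtree n}).

(* Neither choice matters: see fvar_valE. *)
Definition fvar_val (v : fvar p T) : F :=
  match v with
  | inl j => xvar (Sigma (regtree_root n)) (rshift n j)
  | inr w => xvar (Sigma (val (component_rep w))) (lshift p (val w).1)
  end.

Definition eval_at_ZT (f : {mpoly K[#|{: fvar p T}|]}) : F :=
  mmap iota (fun j => fvar_val (enum_val j)) f.

Definition ZT (y : F) : Prop :=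
  exists (t : T) (i : 'I_(n + p)), y = xvar (Sigma (val t)) i.

End Evaluation.

Section ExchangeIdeal.
Variables (Sigma : regtree n -> labeled_seed) (T : {fset regtree n}).
Local Notation PT := {mpoly K[#|{: fvar p T}|]}.

Definition fX (v : fvar p T) : PT := 'X_(enum_rank v).

(* The exchange polynomial of the edge e = (t, t', k) joining t and t' with
   label k; exchanging t and t' permutes the two monomials. *)
Definition exchange_poly (e : T * T * 'I_n) : PT :=
  let: (t, t', k) := e in
  let B := exmx (Sigma (val t)) in
  fX (fvar_at t (lshift p k)) * fX (fvar_at t' (lshift p k))
  - \prod_(i | 0 < B i k) fX (fvar_at t i) ^+ `|B i k|%N
  - \prod_(i | B i k < 0) fX (fvar_at t i) ^+ `|B i k|%N.

Definition in_IT (f : PT) : Prop :=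
  exists c : T * T * 'I_n -> PT,
    f = \sum_(e | tedge e.2 (val e.1.1) (val e.1.2)) c e * exchange_poly e.

Definition MT : PT := \prod_(v : mutable_var T) fX (inr v).

Definition in_JT (f : PT) : Prop := exists a : nat, in_IT (MT ^+ a * f).

End ExchangeIdeal.

Lemma xvar_tedge (Sigma : regtree n -> labeled_seed) k t t' i :
  is_seed_pattern Sigma -> tedge k t t' -> i != lshift p k ->
  xvar (Sigma t') i = xvar (Sigma t) i.
Proof. by move=> [_ mutS] /mutS -> /negbTE nik; rewrite /= ffunE nik. Qed.

Lemma xvar_frozen (Sigma : regtree n -> labeled_seed) t j :
  is_seed_pattern Sigma ->
  xvar (Sigma t) (rshift n j) = xvar (Sigma (regtree_root n)) (rshift n j).
Proof.
move=> patS; case: t => w; elim: w => [|k w IHw] wP.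
  by congr (xvar (Sigma _) _); exact: val_inj.
have wP' : reduced w by move: wP; rewrite /reduced /= => /path_sorted.
rewrite -(IHw wP'); apply: (@xvar_tedge _ k) => //.
  by rewrite /tedge eqxx.
by rewrite eq_rlshift.
Qed.

(* The value of a formal variable is the cluster variable with index i in every
   labeled seed at a vertex of the component. *)
Lemma fvar_valE (Sigma : regtree n -> labeled_seed) (T : {fset regtree n})
    (t : T) (i : 'I_(n + p)) :
  is_seed_pattern Sigma ->
  fvar_val Sigma (fvar_at t i) = xvar (Sigma (val t)) i.
Proof.
move=> patS; rewrite /fvar_at; case: split_ordP => j -> /=; last first.
  by rewrite xvar_frozen.
have := xchooseP (component_neq0 (comp_var j t)).
rewrite -/(component_rep _) inE => /connectP[s pth ->].
elim: s t pth => //= u s IHs t /andP[/existsP[k /andP[nkj tu]] pth].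
rewrite IHs //; apply: (xvar_tedge patS tu).
by rewrite (inj_eq (@lshift_inj _ _)) eq_sym.
Qed.

End Seeds.

Definition subalg_gen (S : F -> Prop) : {pred F} := fun y =>
  `[< forall P : F -> Prop,
        (forall c, P (iota c)) ->
        (forall z, S z -> P z) ->
        (forall y z, P y -> P z -> P (y + z)) ->
        (forall y z, P y -> P z -> P (y * z)) -> P y >].

Lemma subalg_gen_subring (S : F -> Prop) : subring_closed (subalg_gen S).
Proof.
split=> [|x y /asboolP xS /asboolP yS|x y /asboolP xS /asboolP yS];
  apply/asboolP=> P cP SP addP mulP.
- by rewrite -(rmorph1 iota).
- rewrite -mulN1r -(rmorph1 iota) -rmorphN; apply: (addP); first exact: (xS P cP SP addP mulP).
  by apply: (mulP); [exact: cP|exact: (yS P cP SP addP mulP)].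
- by apply: (mulP); [exact: (xS P cP SP addP mulP)|exact: (yS P cP SP addP mulP)].
Qed.
HB.instance Definition _ (S : F -> Prop) :=
  GRing.isSubringClosed.Build F (subalg_gen S) (subalg_gen_subring S).

Record subalg (S : F -> Prop) := Subalg {
  subalg_val : F;
  _ : subalg_val \in subalg_gen S }.
HB.instance Definition _ (S : F -> Prop) := [isSub for @subalg_val S].
HB.instance Definition _ (S : F -> Prop) := [Choice of subalg S by <:].
HB.instance Definition _ (S : F -> Prop) :=
  [SubChoice_isSubComNzRing of subalg S by <:].

End ClusterAlgebras.

(* Main.v *)
(* Work in Q = C[z_T] / J_T, where every mutable formal variable is a regular
   element. Say that q in Q is an initial fraction if v q = u for two
   polynomials u, v in the variables of one fixed seed t0 in T, with v regular
   in Q. If z z' = N along an edge and z, N are initial fractions, v z = u and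
   v' N = u', then (v' u) z' = v u', and v' u = v' v z is again regular. As T is
   connected, every element of Q is an initial fraction; no Laurent phenomenon
   is needed. If now f evaluates to 0 and v f = u in Q, then u evaluates to 0,
   so u = 0 by algebraic independence of the seed at t0, and f = 0 in Q because
   v is regular. *)
Require Import Defs.
From HB Require Import structures.
From mathcomp Require Import all_boot all_order all_algebra.
From mathcomp Require Import finmap.
From mathcomp Require Import mpoly.
From mathcomp Require Import complex boolp reals.

Set Implicit Arguments.
Unset Strict Implicit.
Unset Printing Implicit Defensive.

Import GRing.Theory Num.Theory.
Local Open Scope ring_scope.
Local Open Scope quotient_scope.

(** * Polynomial evaluation and ring morphisms *)

Lemma eq_mmap (n : nat) (A B : nzRingType) (f1 f2 : A -> B) (h1 h2 : 'I_n -> B) :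
  f1 =1 f2 -> h1 =1 h2 -> mmap f1 h1 =1 mmap f2 h2.
Proof.
move=> eqf eqh g; apply: eq_bigr => m _; rewrite eqf; congr (_ * _).
exact: mmap1_eq.
Qed.

Lemma rmorph_mmap (n : nat) (A : nzRingType) (B C : comNzRingType) (f : A -> B)
    (h : 'I_n -> B) (phi : {rmorphism B -> C}) (g : {mpoly A[n]}) :
  phi (mmap f h g) = mmap (phi \o f) (phi \o h) g.
Proof.
rewrite /mmap rmorph_sum; apply: eq_bigr => m _; rewrite rmorphM.
by rewrite /mmap1 rmorph_prod; under eq_bigr do rewrite rmorphXn.
Qed.

(** * The exchange ideal, its saturation and the formal variables *)

Section SaturatedIdeal.
Variables (K F : fieldType) (n p : nat).
Variables (Sigma : regtree n -> labeled_seed F n p) (T : {fset regtree n}).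
Local Notation PT := {mpoly K[#|{: fvar p T}|]}.
Implicit Types f g : PT.

Lemma in_IT0 : in_IT Sigma (0 : PT).
Proof. by exists (fun=> 0); rewrite big1 // => e _; rewrite mul0r. Qed.

Lemma in_ITD f g : in_IT Sigma f -> in_IT Sigma g -> in_IT Sigma (f + g).
Proof.
move=> [c ->] [d ->]; exists (fun e => c e + d e); rewrite -big_split.
by apply: eq_bigr => e _; rewrite mulrDl.
Qed.

Lemma in_ITM f g : in_IT Sigma g -> in_IT Sigma (f * g).
Proof.
move=> [c ->]; exists (fun e => f * c e); rewrite mulr_sumr.
by apply: eq_bigr => e _; rewrite mulrA.
Qed.

Lemma in_IT_exchange (e : T * T * 'I_n) :
  tedge e.2 (val e.1.1) (val e.1.2) -> in_IT Sigma (exchange_poly K Sigma e).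
Proof.
move=> te; exists (fun e' => (e' == e)%:R); rewrite (bigD1 e) //= eqxx mul1r.
by rewrite big1 ?addr0 // => e' /andP[_ /negbTE ->]; rewrite mul0r.
Qed.

Lemma in_IT_JT f : in_IT Sigma f -> in_JT Sigma f.
Proof. by exists 0%N; rewrite expr0 mul1r. Qed.

Lemma in_JTD f g : in_JT Sigma f -> in_JT Sigma g -> in_JT Sigma (f + g).
Proof.
move=> [a fI] [b gI]; exists (a + b)%N; rewrite mulrDr exprD.
apply: in_ITD; last by rewrite -mulrA; exact: in_ITM.
by rewrite mulrAC mulrC; exact: in_ITM.
Qed.

Lemma in_JTM f g : in_JT Sigma g -> in_JT Sigma (f * g).
Proof. by move=> [a gI]; exists a; rewrite mulrCA; exact: in_ITM. Qed.

(** The extra factor is absorbed in the exponent of the saturation. This is what makes [MT], and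
    hence each of its factors, regular modulo $J_T$. *)
Lemma in_JT_MT f : in_JT Sigma (MT K p T * f) -> in_JT Sigma f.
Proof. by move=> [a fI]; exists a.+1; rewrite exprSr -mulrA. Qed.

(** A mutable variable is found at any vertex of its component; a frozen one is found at every
    vertex, so [t0] serves. *)
Lemma fvar_atP (t0 : T) (v : fvar p T) : exists t i, v = fvar_at t i.
Proof.
case: v => [j|[[i C] /= CP]].
  exists t0, (rshift n j); rewrite /fvar_at.
  case: split_ordP => k /eqP; first by rewrite eq_rlshift.
  by rewrite (inj_eq (@rshift_inj _ _)) => /eqP <-.
have /imsetP[t _ eC] := CP.
exists t, (lshift p i); rewrite /fvar_at.
case: split_ordP => k /eqP; last by rewrite eq_lrshift.
rewrite (inj_eq (@lshift_inj _ _)) => /eqP <-.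
by congr inr; apply: val_inj; rewrite /= eC.
Qed.

(** An edge labeled $k$ survives in $T[j]$ for every $j \ne k$, so its two ends lie in the same
    component there. *)
Lemma fvar_at_tedge (k : 'I_n) (t s : T) (i : 'I_(n + p)) :
  tedge k (val t) (val s) -> i != lshift p k -> fvar_at s i = fvar_at t i.
Proof.
move=> ts; rewrite /fvar_at; case: split_ordP => // j ->.
rewrite (inj_eq (@lshift_inj _ _)) => nkj; congr inr; apply: val_inj.
have adj u w : tedge k (val u) (val w) -> connect (del_adj j) u w.
  by move=> uw; apply/connect1/existsP; exists k; rewrite eq_sym nkj.
congr (_, _); apply/setP => w; rewrite !inE.
apply/idP/idP; apply: connect_trans; apply: adj => //.
by rewrite tedge_sym.
Qed.

End SaturatedIdeal.

(** * Evaluation at the cluster and coefficient variables *)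

Section Evaluation.
Variables (K F : fieldType) (iota : {rmorphism K -> F}) (n p : nat).
Variables (Sigma : regtree n -> labeled_seed F n p) (T : {fset regtree n}).
Local Notation PT := {mpoly K[#|{: fvar p T}|]}.

HB.instance Definition _ := GRing.RMorphism.copy (@eval_at_ZT K F iota n p Sigma T)
  (mmap iota (fun j => fvar_val Sigma (enum_val j))).

Lemma eval_fX (v : fvar p T) : eval_at_ZT iota Sigma (fX K v) = fvar_val Sigma v.
Proof. by rewrite /eval_at_ZT mmapX mmap1U enum_rankK. Qed.

Lemma evalC (c : K) : eval_at_ZT iota Sigma (c%:MP : PT) = iota c.
Proof. exact: mmapC. Qed.

Lemma eval_in_subalg (t0 : T) (f : PT) : is_seed_pattern iota Sigma ->
  eval_at_ZT iota Sigma f \in subalg_gen iota (ZT Sigma T).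
Proof.
move=> patS; apply: rpred_sum => m _; apply: rpredM.
  by apply/asboolP => P cP *; exact: cP.
apply: rpred_prod => i _; apply: rpredX; apply/asboolP => P _ zP _ _.
apply: zP; have [t [j ->]] := fvar_atP t0 (enum_val i).
by exists t, j; rewrite (fvar_valE _ _ patS).
Qed.

Lemma subalg_eval (y : F) : is_seed_pattern iota Sigma ->
  y \in subalg_gen iota (ZT Sigma T) -> exists f : PT, eval_at_ZT iota Sigma f = y.
Proof.
move=> patS /asboolP.
(* The image of evaluation contains the scalars and the generators and is closed under sums and
   products, so it contains the generated subalgebra. *)
move=> /(_ (fun y => exists f : PT, eval_at_ZT iota Sigma f = y)); apply.
- by move=> c; exists c%:MP; rewrite evalC.
- move=> z [t [i ->]]; exists (fX K (fvar_at t i)).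
  by rewrite eval_fX (fvar_valE _ _ patS).
- by move=> _ _ [f <-] [g <-]; exists (f + g); rewrite rmorphD.
- by move=> _ _ [f <-] [g <-]; exists (f * g); rewrite rmorphM.
Qed.

Hypothesis patS : is_seed_pattern iota Sigma.

(** If $x_i$ were zero, the polynomial $X_i$ would be an algebraic relation. *)
Lemma xvar_neq0 (t : regtree n) (i : 'I_(n + p)) : xvar (Sigma t) i != 0.
Proof.
have [+ _ _] := patS.1 t; move=> /(_ 'X_i) indep; apply/eqP => x0.
have := indep; rewrite mmapX mmap1U => /(_ x0) /(congr1 (mcoeff U_(i))).
by rewrite mcoeffX eqxx mcoeff0 => /eqP; rewrite oner_eq0.
Qed.

Lemma exmx_diag (t : regtree n) (k : 'I_n) : exmx (Sigma t) (lshift p k) k = 0.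
Proof.
have [_ _ [d [d_gt0 /(_ k k)]]] := patS.1 t; rewrite mxE => /eqP.
rewrite -subr_eq0 opprK -mulrDr mulf_eq0 -mulr2n mulrn_eq0 /= => /orP[|/eqP//].
by move=> /eqP[] d0; have := d_gt0 k; rewrite d0.
Qed.

Lemma eval_exchange (e : T * T * 'I_n) :
  tedge e.2 (val e.1.1) (val e.1.2) ->
  eval_at_ZT iota Sigma (exchange_poly K Sigma e) = 0.
Proof.
case: e => [[t t'] k] /= tt'; rewrite !rmorphB rmorphM /= !eval_fX !(fvar_valE _ _ patS).
(* Mutation defines $x_k'$ by dividing by $x_k \ne 0$, so $x_k x_k'$ is the numerator. *)
rewrite (patS.2 _ _ _ tt') /= ffunE eqxx mulrC divfK ?xvar_neq0 //.
rewrite !rmorph_prod /=.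
under [X in _ - X - _]eq_bigr do rewrite rmorphXn /= eval_fX (fvar_valE _ _ patS).
under [X in _ - X]eq_bigr do rewrite rmorphXn /= eval_fX (fvar_valE _ _ patS).
by rewrite addrAC addrK subrr.
Qed.

Lemma eval_in_IT (f : PT) : in_IT Sigma f -> eval_at_ZT iota Sigma f = 0.
Proof.
move=> [c ->]; rewrite rmorph_sum big1 // => e te.
by rewrite rmorphM /= eval_exchange ?mulr0.
Qed.

(** $M_T$ evaluates to a product of nonzero elements of the field [F], so its powers cancel. *)
Lemma eval_in_JT (t0 : T) (f : PT) : in_JT Sigma f -> eval_at_ZT iota Sigma f = 0.
Proof.
move=> [a /eval_in_IT /eqP]; rewrite rmorphM rmorphXn mulf_eq0 /= => /orP[|/eqP//].
rewrite expf_eq0 => /andP[_]; rewrite rmorph_prod /= => /prodf_eq0[v _].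
have [t [i ->]] := fvar_atP t0 (inr v : fvar p T).
by rewrite eval_fX (fvar_valE _ _ patS) (negbTE (xvar_neq0 _ _)).
Qed.

(** * The quotient by the saturated ideal *)

Definition JT_pred : {pred PT} := fun f => `[< in_JT Sigma f >].

Variable t0 : T.

Lemma JT_idealr : idealr_closed JT_pred.
Proof.
split=> [||a f g /asboolP fJ /asboolP gJ].
- by apply/asboolP/in_IT_JT/in_IT0.
(* The ideal is proper: its elements evaluate to 0, whereas 1 evaluates to 1. *)
- apply/asboolP => /(eval_in_JT t0)/eqP.
  by rewrite rmorph1 oner_eq0.
- by apply/asboolP/in_JTD => //; exact: in_JTM.
Qed.

Definition JT : idealr PT := HB.pack_for (idealr PT) JT_pred
  (isIdealr.Build PT JT_pred JT_idealr).

Lemma JTP (f : PT) : f \in JT <-> in_JT Sigma f.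
Proof. by split=> /asboolP. Qed.

Local Notation Q := {ideal_quot JT}.
Local Notation class := (\pi_Q : PT -> Q).

Lemma class_eq0 (f : PT) : class f = 0 <-> in_JT Sigma f.
Proof.
have e0 : (class f == class 0) = (f \in JT) by rewrite -Quotient.idealrBE subr0.
rewrite -JTP -e0 -(rmorph0 class); exact: (rwP eqP).
Qed.

(** Saturation makes $M_T$ regular in the quotient, and in a commutative ring a factor of a regular
    element is regular. *)
Lemma lreg_class_fX (v : mutable_var T) : GRing.lreg (class (fX K (inr v))).
Proof.
have : GRing.lreg (class (MT K p T)).
  apply: mulrI0_lreg => q; elim/quotW: q => f.
  by rewrite -rmorphM !class_eq0 => /in_JT_MT.
by rewrite /MT (bigD1 v) //= mulrC rmorphM; exact: GRing.lregMl.
Qed.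

(** * Fractions in the variables of the initial seed *)

Definition initial_eval : {mpoly K[n + p]} -> PT :=
  mmap (@mpolyC _ K) (fun i => fX K (fvar_at t0 i)).
HB.instance Definition _ := GRing.RMorphism.copy initial_eval
  (mmap (@mpolyC _ K) (fun i => fX K (fvar_at t0 i))).

Definition initial_class : {mpoly K[n + p]} -> Q := fun g => class (initial_eval g).
HB.instance Definition _ := GRing.RMorphism.copy initial_class (class \o initial_eval).

Lemma eval_initial_eval (g : {mpoly K[n + p]}) :
  eval_at_ZT iota Sigma (initial_eval g) = mmap iota (xvar (Sigma (val t0))) g.
Proof.
rewrite rmorph_mmap; apply: eq_mmap => [c|i] /=; first exact: evalC.
by rewrite eval_fX (fvar_valE _ _ patS).
Qed.

(** The denominator stays on the left-hand side: [Q] is not yet known to be a domain, and regularity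
    of [initial_class v] is what allows cancelling it. *)
Definition initial_fraction (q : Q) : Prop :=
  exists u v, GRing.lreg (initial_class v) /\ initial_class v * q = initial_class u.

Lemma initial_fraction_initial g : initial_fraction (initial_class g).
Proof. by exists g, 1; rewrite rmorph1 mul1r; split=> //; exact: lreg1. Qed.

Lemma initial_fractionD q r :
  initial_fraction q -> initial_fraction r -> initial_fraction (q + r).
Proof.
move=> [u [v [v_reg vq]]] [u' [v' [v'_reg vr]]]; exists (v' * u + v * u'), (v * v').
rewrite !(rmorphD initial_class) !(rmorphM initial_class) /=; split; first exact: lregM.
by rewrite -vq -vr mulrDr -!mulrA (mulrCA (initial_class v)).
Qed.

Lemma initial_fractionM q r :
  initial_fraction q -> initial_fraction r -> initial_fraction (q * r).
Proof.
move=> [u [v [v_reg vq]]] [u' [v' [v'_reg vr]]]; exists (u * u'), (v * v').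
rewrite !(rmorphM initial_class) /=; split; first exact: lregM.
by rewrite -vq -vr mulrACA.
Qed.

(** Solves an exchange relation for the new variable; regularity of [z] keeps the new denominator
    regular. *)
Lemma initial_fraction_div z z' :
  GRing.lreg z -> initial_fraction z -> initial_fraction (z * z') ->
  initial_fraction z'.
Proof.
move=> z_reg [u [v [v_reg vz]]] [u' [v' [v'_reg vzz']]].
exists (v * u'), (v' * u); rewrite !(rmorphM initial_class) /= -vz -vzz'; split.
  by do 2!apply: lregM => //.
by rewrite -!mulrA mulrCA.
Qed.

Lemma initial_fractionX q a : initial_fraction q -> initial_fraction (q ^+ a).
Proof.
move=> qP; elim: a => [|a IHa]; last by rewrite exprS; exact: initial_fractionM.
by rewrite expr0 -(rmorph1 initial_class); exact: initial_fraction_initial.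
Qed.

Lemma initial_fraction_prod (I : Type) (r : seq I) (P : pred I) (q : I -> Q) :
  (forall i, P i -> initial_fraction (q i)) ->
  initial_fraction (\prod_(i <- r | P i) q i).
Proof.
move=> qP; elim/big_ind: _ => //; last exact: initial_fractionM.
by rewrite -(rmorph1 initial_class); exact: initial_fraction_initial.
Qed.

Lemma initial_fraction_fvar_at (t : T) (i : 'I_(n + p)) :
  connect (@sub_adj n T) t0 t -> initial_fraction (class (fX K (fvar_at t i))).
Proof.
move=> /connectP[s pth ->].
have init_t0 j : initial_fraction (class (fX K (fvar_at t0 j))).
  suff -> : class (fX K (fvar_at t0 j)) = initial_class 'X_j.
    exact: initial_fraction_initial.
  by rewrite /initial_class /initial_eval mmapX mmap1U.
(* Generalizing the start of the path to [w] lets the induction pass the property of a whole seed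
   from each vertex to the next. *)
suff step : forall w, path (@sub_adj n T) w s ->
    (forall j, initial_fraction (class (fX K (fvar_at w j)))) ->
  forall j, initial_fraction (class (fX K (fvar_at (last w s) j))).
  exact: step pth init_t0 i.
elim: s {pth} => //= u s IHs w /andP[/existsP[k wu] pth] wP.
apply: IHs pth _ => j.
have [->|/(fvar_at_tedge wu) ->//] := eqVneq j (lshift p k).
(* At the exchanged index the relation holds in [Q], and both of its monomials are written in the
   variables at [w], already known to be initial fractions. *)
have /class_eq0/eqP := in_IT_JT (@in_IT_exchange K F n p Sigma T (w, u, k) wu).
rewrite /= !rmorphB rmorphM /= -addrA -opprD subr_eq0 => /eqP exch.
apply: initial_fraction_div (wP (lshift p k)) _.
  rewrite /fvar_at; case: split_ordP => l /eqP; last by rewrite eq_lrshift.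
  by move=> _; exact: lreg_class_fX.
rewrite exch !rmorph_prod /=.
apply: initial_fractionD; apply: initial_fraction_prod => l _;
  rewrite rmorphXn; apply: initial_fractionX; exact: wP.
Qed.

Hypothesis T_conn : forall t, connect (@sub_adj n T) t0 t.

Lemma all_initial_fraction (f : PT) : initial_fraction (class f).
Proof.
elim/mpolyind: f => [|c m f _ _ fP].
  by rewrite -(rmorph0 initial_eval); exact: initial_fraction_initial.
rewrite rmorphD; apply: initial_fractionD => //.
rewrite -mul_mpolyC rmorphM; apply: initial_fractionM.
  suff -> : c%:MP = initial_eval c%:MP by exact: initial_fraction_initial.
  by rewrite /initial_eval mmapC.
rewrite mpolyXE_id rmorph_prod; apply: initial_fraction_prod => j _.
rewrite rmorphXn; apply: initial_fractionX.
rewrite -[j]enum_valK; have [t [i ->]] := fvar_atP t0 (enum_val j).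
exact: initial_fraction_fvar_at.
Qed.

(** * The kernel of evaluation and the induced isomorphism *)

Lemma eval_eq0P (f : PT) : eval_at_ZT iota Sigma f = 0 <-> in_JT Sigma f.
Proof.
split; last exact: eval_in_JT.
move=> f0; have [u [v [v_reg vf]]] := all_initial_fraction f.
have [indep _ _] := patS.1 (val t0).
suff u0 : u = 0.
  by apply/class_eq0/v_reg; rewrite mulr0 vf u0 (rmorph0 initial_class).
apply: indep; rewrite -eval_initial_eval; apply/eqP; rewrite -oppr_eq0.
(* Evaluating the congruence $vf \equiv u$ modulo $J_T$ turns the vanishing of [f] into that of
   [u]. *)
have /(eval_in_JT t0) : in_JT Sigma (initial_eval v * f - initial_eval u).
  by apply/class_eq0; rewrite rmorphB rmorphM; apply/eqP; rewrite subr_eq0; apply/eqP.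
by rewrite rmorphB rmorphM /= f0 mulr0 sub0r => /eqP.
Qed.

(** Two representatives differ by an element of $J_T$, which evaluates to 0; hence evaluation may be
    computed on the representative chosen by [repr]. *)
Lemma eval_repr_class (f : PT) :
  eval_at_ZT iota Sigma (repr (class f)) = eval_at_ZT iota Sigma f.
Proof.
apply/eqP; rewrite -subr_eq0 -rmorphB; apply/eqP/(eval_in_JT t0)/class_eq0.
by rewrite rmorphB /= reprK subrr.
Qed.

Definition quotient_eval (q : Q) : subalg iota (ZT Sigma T) :=
  Subalg (eval_in_subalg t0 (repr q) patS).

Lemma val_quotient_eval (f : PT) :
  val (quotient_eval (class f)) = eval_at_ZT iota Sigma f.
Proof. exact: eval_repr_class. Qed.

Fact quotient_eval_additive : additive quotient_eval.
Proof.
move=> q r; elim/quotW: q => f; elim/quotW: r => g; apply: val_inj.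
rewrite -(rmorphB class) [LHS]val_quotient_eval !rmorphB /=.
by rewrite !eval_repr_class.
Qed.

Fact quotient_eval_multiplicative : multiplicative quotient_eval.
Proof.
split=> [q r|]; apply: val_inj.
  elim/quotW: q => f; elim/quotW: r => g.
  by rewrite -(rmorphM class) [LHS]val_quotient_eval !rmorphM /= !eval_repr_class.
by rewrite -(rmorph1 class) [LHS]val_quotient_eval !rmorph1.
Qed.

HB.instance Definition _ := GRing.isAdditive.Build Q (subalg iota (ZT Sigma T))
  quotient_eval quotient_eval_additive.
HB.instance Definition _ := GRing.isMultiplicative.Build Q
  (subalg iota (ZT Sigma T)) quotient_eval quotient_eval_multiplicative.

Lemma quotient_eval_bij : bijective quotient_eval.
Proof.
(* Surjectivity is put in boolean form so that [xchoose] can select preimages, which give the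
   inverse map. *)
have sur (y : subalg iota (ZT Sigma T)) : exists q, quotient_eval q == y.
  have [f fy] := subalg_eval patS (valP y); exists (class f).
  by apply/eqP/val_inj; rewrite val_quotient_eval.
exists (fun y => xchoose (sur y)); last by move=> y; exact/eqP/(xchooseP (sur y)).
(* The chosen preimage of the image of [q] is [q] itself by injectivity, that is, because the kernel
   of evaluation is $J_T$. *)
suff inj : injective quotient_eval by move=> q; exact/inj/eqP/(xchooseP (sur _)).
apply: raddf_inj => q; elim/quotW: q => f /(congr1 val).
by rewrite /= -/(val _) eval_repr_class => /eval_eq0P/class_eq0.
Qed.

End Evaluation.

Theorem theorem6p8p10 (R : realType) (n p : nat) (F : fieldType)
    (iota : {rmorphism R[i] -> F})
    (F_rational : is_rational_function_field iota (n + p))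
    (Sigma : regtree n -> labeled_seed F n p)
    (Sigma_pattern : is_seed_pattern iota Sigma)
    (T : {fset regtree n}) (T_subtree : is_subtree T) :
  (forall f : {mpoly R[i][#|{: fvar p T}|]},
      eval_at_ZT iota Sigma f = 0 <-> in_JT Sigma f) /\
  (exists J : idealr {mpoly R[i][#|{: fvar p T}|]},
      (forall f, f \in J <-> in_JT Sigma f) /\
      exists phi : {rmorphism {ideal_quot J} -> subalg iota (ZT Sigma T)},
        bijective phi /\
        forall f, val (phi (\pi_({ideal_quot J}) f)) = eval_at_ZT iota Sigma f).
Proof.
(* Any vertex of the nonempty subtree can carry the initial seed, since all the others are connected
   to it. *)
have [/fset0Pn[t tT] conn] := T_subtree.
pose t0 : T := [` tT]%fset.
split; first by move=> f; exact: eval_eq0P (conn t0) f.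
exists (JT Sigma_pattern t0); split; first exact: JTP.
exists (@quotient_eval _ _ _ _ _ _ _ Sigma_pattern t0); split.
  exact: quotient_eval_bij (conn t0).
exact: val_quotient_eval.
Qed.
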